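(* Let $A\in\mathbf{R}^{2\times 2}$ be symmetric with eigen-decomposition $A=V\Lambda V^T$, where $V=(v_1,v_2)$ is orthogonal and $\Lambda=\mathrm{diag}(\lambda_1,\lambda_2)$, with $\lambda_2\le\lambda_1$, $|\lambda_2|\le|\lambda_1|$ and $\lambda_1>0$. Let $b\in\mathbf{R}^2$, let $f(x)=\tfrac12x^TAx-b^Tx$, and suppose that $\lambda_1$ is known. Given $x^{(0)}\in\mathbf{R}^2$, let $x^{(1)}=x^{(0)}-\tfrac1{\lambda_1}g^{(0)}$ be obtained by one gradient descent step of size $1/\lambda_1$. Then a stationary point of $f$ and its nature are found in precisely 2 steps of a gradient based method (gradient descent with step lengths $1/\lambda_1$ and then $1/\lambda_2$), and a full eigen-decomposition of $A$ is available after 2 iterations. Specifically: (i) $x^{(1)}=\bigl(1-\tfrac{\lambda_2}{\lambda_1}\bigr)(v_2^Tx^{(0)})v_2+\tfrac1{\lambda_1}b$, so $x^{(1)}-\tfrac1{\lambda_1}b$ lies in the 1-dimensional subspace spanned by $v_2$. A unit eigenvector $v_2$ is recovered immediately as $$v_2=\bigl(x^{(1)}-\tfrac1{\lambda_1}b\bigr)\big/\bigl\|x^{(1)}-\tfrac1{\lambda_1}b\bigr\|_2,$$ with corresponding eigenvalue $\lambda_2=v_2^TAv_2/(v_2^Tv_2)$. If $v_1$ is also available and $\lambda_2\neq0$, then the stationary point of $f$ is recovered as $x^*=\tfrac1{\lambda_1}(v_1^Tb)v_1+\tfrac1{\lambda_2}(v_2^Tb)v_2$. (ii) $g^{(1)}=\lambda_2\bigl(1-\tfrac{\lambda_2}{\lambda_1}\bigr)(v_2^Tx^{(0)})v_2-Hb$.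 If $g^{(1)}+Hb=0$, then $\lambda_2=0$. Otherwise, the unit eigenvector $v_2$ can also be recovered as $v_2=(g^{(1)}+Hb)/\|g^{(1)}+Hb\|_2$. (iii) If $\lambda_2\neq0$, then the second step $x^{(2)}=x^{(1)}-\tfrac1{\lambda_2}g^{(1)}$, of size $1/\lambda_2$, gives $$x^{(2)}=\tfrac1{\lambda_1}(v_1^Tb)v_1+\tfrac1{\lambda_2}(v_2^Tb)v_2=x^*,$$ the stationary point of $f$, and $g^{(2)}=0$. If both eigenvalues are positive, the stationary point is a minimizer; if they have opposite signs, it is a saddle point. (iv) If $\lambda_2=0$, then $A$ is rank deficient, $x^{(1)}=(v_2^Tx^{(0)})v_2+\tfrac1{\lambda_1}\bigl((v_1^Tb)v_1+(v_2^Tb)v_2\bigr)$, and $g^{(1)}=(v_2^Tb)v_2$. If $b\in\mathrm{range}(A)$, then $g^{(1)}=0$ and $x^{(1)}$ is a minimizer of $f$. If $b\notin\mathrm{range}(A)$, then $(v_2^Tb)v_2\neq0$ is the projection of $b$ onto $v_2$, again $x^{(1)}$ is a minimizer of $f$, and $\|g^{(1)}\|_2=v_2^Tb$.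
   Context: Here $g^{(k)}=Ax^{(k)}-b$ denotes the gradient of $f$ at $x^{(k)}$, and $H=I-\tfrac1{\lambda_1}A$, where $I$ is the identity matrix. A stationary point of $f$ is a point where the gradient $Ax-b$ vanishes.
   Formalization: Recovering v2, the full decomposition and ''g1+Hb=0 implies λ2=0'' assume λ2≠λ1 and v2ᵀx0≠0; v2 is found up to sign; if λ2=0, g1=−(v2ᵀb)v2 with norm |v2ᵀb|; for b outside range(A), f has no minimizer, so x1 minimizes f on x1+range(A) and the gradient norm. *)

(* Defs.v *)
From HB Require Import structures.
From mathcomp Require Import all_boot all_order all_algebra.
From mathcomp Require Import ring lra.
From mathcomp Require Import all_classical all_reals all_analysis.

Set Implicit Arguments.
Unset Strict Implicit.
Unset Printing Implicit Defensive.

Import Order.TTheory GRing.Theory Num.Theory.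
Import numFieldNormedType.Exports.

Local Open Scope classical_set_scope.
Local Open Scope ring_scope.

(* MathComp-Analysis equips matrices with the sup norm, so the Euclidean inner
   product and norm are introduced here; both norms induce the same topology. *)
Definition dotv (R : realType) (n : nat) (u v : 'cV[R]_n) : R :=
  (u^T *m v) 0 0.

Definition norm2 (R : realType) (n : nat) (u : 'cV[R]_n) : R :=
  Num.sqrt (dotv u u).

Definition normalize (R : realType) (n : nat) (u : 'cV[R]_n) : 'cV[R]_n :=
  (norm2 u)^-1 *: u.

Definition rayleigh (R : realType) (n : nat) (A : 'M[R]_n) (u : 'cV[R]_n) : R :=
  dotv u (A *m u) / dotv u u.

Definition quadf (R : realType) (n : nat) (A : 'M[R]_n) (b x : 'cV[R]_n) : R :=
  2^-1 * dotv x (A *m x) - dotv b x.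

(* For symmetric A this is the gradient of [quadf A b], see [quadf_is_derive]. *)
Definition grad (R : realType) (n : nat) (A : 'M[R]_n) (b x : 'cV[R]_n) :
  'cV[R]_n := A *m x - b.

Definition stationary (R : realType) (n : nat) (A : 'M[R]_n)
  (b x : 'cV[R]_n) : Prop := grad A b x = 0.

Definition gd_step (R : realType) (n : nat) (A : 'M[R]_n) (b : 'cV[R]_n)
  (alpha : R) (x : 'cV[R]_n) : 'cV[R]_n := x - alpha *: grad A b x.

Definition minimizer (R : realType) (n : nat) (F : 'cV[R]_n -> R)
  (x : 'cV[R]_n) : Prop := forall y, F x <= F y.

Definition minimizer_on (R : realType) (n : nat) (S : set 'cV[R]_n)
  (F : 'cV[R]_n -> R) (x : 'cV[R]_n) : Prop :=
  S x /\ forall y, S y -> F x <= F y.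

Definition local_min (R : realType) (n : nat) (F : 'cV[R]_n -> R)
  (x : 'cV[R]_n) : Prop := \forall y \near x, F x <= F y.

Definition local_max (R : realType) (n : nat) (F : 'cV[R]_n -> R)
  (x : 'cV[R]_n) : Prop := \forall y \near x, F y <= F x.

Definition saddle_point (R : realType) (n : nat) (A : 'M[R]_n)
  (b x : 'cV[R]_n) : Prop :=
  [/\ stationary A b x, ~ local_min (quadf A b) x & ~ local_max (quadf A b) x].

(* p is the orthogonal projection of b onto the line spanned by v *)
Definition is_proj_on (R : realType) (n : nat) (v b p : 'cV[R]_n) : Prop :=
  p \in <[v]>%VS /\ dotv v (b - p) = 0.

Definition diag2 (R : realType) (a c : R) : 'M[R]_2 :=
  diag_mx (\row_(i < 2) if i == 0 then a else c).

(* (V, diag (a, c)) is an orthogonal eigen-decomposition of A *)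
Definition eigen_decomposition (R : realType) (A V : 'M[R]_2) (a c : R) : Prop :=
  V^T *m V = 1%:M /\ A = V *m diag2 a c *m V^T.

(* rotation by a right angle: computes from a unit vector of the plane a unit
   vector orthogonal to it *)
Definition rot90 (R : realType) (u : 'cV[R]_2) : 'cV[R]_2 :=
  \col_(i < 2) if i == 0 then - u 1 0 else u 0 0.

Lemma dotvC (R : realType) (n : nat) (u v : 'cV[R]_n) : dotv u v = dotv v u.
Proof. by rewrite /dotv !mxE; apply: eq_bigr => i _; rewrite !mxE mulrC. Qed.

Lemma dotvDl (R : realType) (n : nat) (u v w : 'cV[R]_n) :
  dotv (u + v) w = dotv u w + dotv v w.
Proof. by rewrite /dotv linearD mulmxDl !mxE. Qed.

Lemma dotvDr (R : realType) (n : nat) (u v w : 'cV[R]_n) :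
  dotv w (u + v) = dotv w u + dotv w v.
Proof. by rewrite !(dotvC w) dotvDl. Qed.

Lemma dotvZl (R : realType) (n : nat) (a : R) (u v : 'cV[R]_n) :
  dotv (a *: u) v = a * dotv u v.
Proof. by rewrite /dotv linearZ -scalemxAl !mxE. Qed.

Lemma dotvZr (R : realType) (n : nat) (a : R) (u v : 'cV[R]_n) :
  dotv v (a *: u) = a * dotv v u.
Proof. by rewrite dotvC dotvZl dotvC. Qed.

Lemma dotv_sym (R : realType) (n : nat) (A : 'M[R]_n) (u v : 'cV[R]_n) :
  A^T = A -> dotv u (A *m v) = dotv v (A *m u).
Proof. by move=> sA; rewrite dotvC /dotv trmx_mul sA mulmxA. Qed.

Lemma quadf_expand (R : realType) (n : nat) (A : 'M[R]_n) (b x v : 'cV[R]_n)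
    (t : R) : A^T = A ->
  quadf A b (t *: v + x) =
  quadf A b x + t * dotv (grad A b x) v + t ^+ 2 * (2^-1 * dotv v (A *m v)).
Proof.
move=> sA; rewrite /quadf /grad -(scaleN1r b).
rewrite mulmxDr -scalemxAr !(dotvDl, dotvDr, dotvZl, dotvZr).
by rewrite (dotv_sym x v sA) (dotvC (A *m x)); field.
Qed.

Lemma quadf_is_derive (R : realType) (n : nat) (A : 'M[R]_n.+1)
    (b x v : 'cV[R]_n.+1) : A^T = A ->
  is_derive x v (quadf A b) (dotv (grad A b x) v).
Proof.
move=> sA; set c := dotv _ v; pose q := 2^-1 * dotv v (A *m v).
have cv : h^-1 *: (quadf A b (h *: v + x) - quadf A b x) @[h --> 0^'] --> c.
  apply: (@cvg_trans _ ((fun h : R => c + h * q) @ 0^')).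
    apply: near_eq_cvg; near=> h.
    have h0 : h != 0 by near: h; exact: nbhs_dnbhs_neq.
    by rewrite quadf_expand // /GRing.scale/= -/c -/q; field.
  rewrite (_ : nbhs c = nbhs (c + 0 * q)); last by rewrite mul0r addr0.
  apply: cvgD; first exact: cvg_cst.
  apply: cvgM; last exact: cvg_cst.
  exact: nbhs_dnbhs.
apply: DeriveDef; first by apply/cvg_ex; exists c.
exact/cvg_lim.
Unshelve. all: by end_near. Qed.

(* First-order condition: when b is outside range A, f has no minimizer. *)
Lemma minimizer_stationary (R : realType) (n : nat) (A : 'M[R]_n)
    (b x : 'cV[R]_n) : A^T = A -> minimizer (quadf A b) x -> stationary A b x.
Proof.
move=> sA mx; set g := grad A b x; rewrite /stationary -/g.
have dge0 (u : 'cV[R]_n) : 0 <= dotv u u.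
  by rewrite /dotv mxE sumr_ge0 // => i _; rewrite mxE -expr2 sqr_ge0.
have g0 : dotv g g = 0.
  pose c := dotv g g; pose q := 2^-1 * dotv g (A *m g).
  have ineq t : 0 <= t * c + t ^+ 2 * q.
    by have := mx (t *: g + x); rewrite quadf_expand // -/g -/c -/q; lra.
  have c0 : 0 <= c by exact: dge0.
  apply/eqP; rewrite eq_le dge0 andbT leNgt; apply/negP => cgt; rewrite -/c in cgt.
  pose t := c / (`|q| + c).
  have dpos : 0 < `|q| + c by rewrite ltr_wpDl.
  have t0 : 0 < t by rewrite divr_gt0.
  have : t * q < c.
    rewrite /t mulrAC ltr_pdivrMr // ltr_pM2l //.
    by apply: (le_lt_trans (ler_norm q)); rewrite ltrDl.
  have := ineq (- t); rewrite sqrrN => /[swap] tq.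
  have -> : - t * c + t ^+ 2 * q = t * (t * q - c) by ring.
  by rewrite pmulr_rge0 // subr_ge0 leNgt tq.
apply/matrixP => i j; rewrite [j]ord1 [RHS]mxE.
move/eqP: g0; rewrite /dotv mxE psumr_eq0.
  by move=> /allP/(_ i (mem_index_enum _)); rewrite /= mxE mulf_eq0 orbb => /eqP.
by move=> k _; rewrite mxE -expr2 sqr_ge0.
Qed.

(* Main.v *)
Require Import Defs.
From mathcomp Require Import all_boot all_order all_algebra.
From mathcomp Require Import ring lra.
From mathcomp Require Import all_classical all_reals all_analysis.

Set Implicit Arguments.
Unset Strict Implicit.
Unset Printing Implicit Defensive.

Import Order.TTheory GRing.Theory Num.Theory.
Import numFieldNormedType.Exports.

Local Open Scope classical_set_scope.
Local Open Scope ring_scope.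

(** Everything is read in the coordinates [dotv v1 x], [dotv v2 x] of a vector
    [x] in the orthonormal eigenbasis. There [A] multiplies the coordinates by
    [lambda1] and [lambda2], so a gradient step of size [alpha] acts on the two
    coordinates separately, as
    [x_i |-> (1 - alpha * lambda_i) * x_i + alpha * b_i].
    With [alpha = 1 / lambda_i] the i-th coordinate therefore lands on its
    stationary value [b_i / lambda_i] at once, and later steps leave it there.
    Hence one step makes the [v1]-coordinate exact and confines [x1 - b / lambda1]
    to the line of [v2], so that normalizing it, when it is nonzero, reveals
    [v2] up to sign, and the step of size [1 / lambda2] makes the other
    coordinate exact.

    A vector is determined by its two coordinates
    ([eigen_decomposition_ext]), which turns each vector identity into two scalar ones. The nature of a point is
    read off from the exact second-order expansion of the quadratic [f]. For
    positive semidefinite [A], [quadf_le_orth_grad] compares [f] at [x] and [y]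
    as soon as the gradient at [x] is orthogonal to [y - x]. This gives global
    minimality at a stationary point; when [lambda2 = 0] and [b] is not in the
    range of [A], the gradient at [x1] is a nonzero multiple of [v2], orthogonal
    to that range, which gives minimality on [x1 + range A]. There the
    [v2]-coordinate of the gradient is [- dotv v2 b] at every point, so
    Cauchy-Schwarz shows that [x1] also minimizes the norm of the gradient. In
    the indefinite case, moving along an eigenvector of negative (resp.
    positive) eigenvalue rules out a local minimum (resp. maximum).
    The eigen-decomposition rebuilt from the computed unit vector [u] is correct because in the plane the
    projector onto the line of [rot90 u] is the identity minus the projector
    onto the line of [u], whatever the sign of [u]. *)

(** * Inner product, norm and normalization *)

Lemma dotvNr (R : realType) (n : nat) (u v : 'cV[R]_n) :
  dotv v (- u) = - dotv v u.
Proof. by rewrite -scaleN1r dotvZr mulN1r. Qed.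

Lemma dotvNl (R : realType) (n : nat) (u v : 'cV[R]_n) :
  dotv (- u) v = - dotv u v.
Proof. by rewrite dotvC dotvNr dotvC. Qed.

Lemma dotv0l (R : realType) (n : nat) (v : 'cV[R]_n) : dotv 0 v = 0.
Proof. by rewrite /dotv trmx0 mul0mx mxE. Qed.

Lemma dotv0r (R : realType) (n : nat) (v : 'cV[R]_n) : dotv v 0 = 0.
Proof. by rewrite dotvC dotv0l. Qed.

Lemma dotv_ge0 (R : realType) (n : nat) (v : 'cV[R]_n) : 0 <= dotv v v.
Proof. by rewrite /dotv mxE sumr_ge0 // => i _; rewrite mxE -expr2 sqr_ge0. Qed.

Lemma mul_cVV (R : realType) (n : nat) (u v w : 'cV[R]_n) :
  u *m v^T *m w = dotv v w *: u.
Proof. by rewrite -mulmxA [v^T *m w]mx11_scalar mul_mx_scalar. Qed.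

Lemma norm2Z (R : realType) (n : nat) (k : R) (v : 'cV[R]_n) :
  dotv v v = 1 -> norm2 (k *: v) = `|k|.
Proof. by move=> v1; rewrite /norm2 dotvZl dotvZr v1 mulr1 -expr2 sqrtr_sqr. Qed.

Lemma normalizeZ (R : realType) (n : nat) (k : R) (v : 'cV[R]_n) :
  dotv v v = 1 -> k != 0 -> normalize (k *: v) = Num.sg k *: v.
Proof.
move=> v1 k0; rewrite /normalize norm2Z // scalerA; congr (_ *: _).
by rewrite {2}(numEsg k) mulrCA mulVf ?mulr1 ?normr_eq0.
Qed.

Lemma sgr_or (R : realType) (n : nat) (k : R) (v : 'cV[R]_n) : k != 0 ->
  Num.sg k *: v = v \/ Num.sg k *: v = - v.
Proof.
by case: sgrP => // _ _; rewrite ?scale1r ?scaleN1r; [left | right].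
Qed.

Lemma norm2_sgZ (R : realType) (n : nat) (k : R) (v : 'cV[R]_n) :
  dotv v v = 1 -> k != 0 -> norm2 (Num.sg k *: v) = 1.
Proof. by move=> v1 k0; rewrite norm2Z // normr_sg k0. Qed.

(** Cauchy-Schwarz for a unit vector [v]: the residual of the projection of [u]
    onto the line of [v] has squared norm [dotv u u - dotv v u ^+ 2]. *)
Lemma normr_dotv_le_norm2 (R : realType) (n : nat) (u v : 'cV[R]_n) :
  dotv v v = 1 -> `|dotv v u| <= norm2 u.
Proof.
move=> v1; rewrite /norm2 -sqrtr_sqr ler_wsqrtr //.
have := dotv_ge0 (u - dotv v u *: v).
rewrite dotvDr dotvNr dotvZr !dotvDl !dotvNl !dotvZl v1 (dotvC u v); lra.
Qed.

(** * The planar eigenbasis *)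

Lemma row_mx2E (R : realType) (n : nat) (v1 v2 : 'cV[R]_n) (i : 'I_n)
    (j : 'I_2) :
  (row_mx v1 v2 : 'M[R]_(n, 2)) i j = (if j == 0 then v1 else v2) i 0.
Proof.
rewrite mxE; case: splitP => k; rewrite [k]ord1 => ej.
  by rewrite (_ : j = 0) //; exact: val_inj.
by rewrite (_ : j = 1) //; exact: val_inj.
Qed.

(** Spectral form of the decomposition: both conditions involve [v1] and [v2]
    only through their rank-one projectors, so they ignore signs. *)
Lemma eigen_decompositionP (R : realType) (A : 'M[R]_2) (v1 v2 : 'cV[R]_2)
    (a c : R) :
  eigen_decomposition A (row_mx v1 v2) a c <->
  v1 *m v1^T + v2 *m v2^T = 1%:M /\
  A = a *: (v1 *m v1^T) + c *: (v2 *m v2^T).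
Proof.
have VW (w1 w2 : 'cV[R]_2) : (row_mx w1 w2 : 'M[R]_2) *m
    (row_mx v1 v2 : 'M[R]_2)^T = w1 *m v1^T + w2 *m v2^T.
  by have := mul_row_col w1 w2 v1^T v2^T; rewrite -tr_row_mx.
have VD : row_mx v1 v2 *m diag2 a c = row_mx (a *: v1) (c *: v2) :> 'M[R]_2.
  apply/matrixP => i j; rewrite mul_mx_diag mxE !row_mx2E.
  by rewrite mxE; case: ifP => _; rewrite mxE mulrC.
rewrite /eigen_decomposition VD VW -!scalemxAl -VW.
by split=> -[VT ->]; split=> //; apply: mulmx1C.
Qed.

Lemma eigen_decomposition_orthonormal (R : realType) (A : 'M[R]_2)
    (v1 v2 : 'cV[R]_2) (a c : R) : eigen_decomposition A (row_mx v1 v2) a c ->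
  [/\ dotv v1 v1 = 1, dotv v2 v2 = 1 & dotv v1 v2 = 0].
Proof.
move=> [/matrixP VV _].
have E (i j : 'I_2) : dotv (if i == 0 then v1 else v2)
    (if j == 0 then v1 else v2) = (1%:M : 'M[R]_2) i j.
  rewrite -VV /dotv !mxE; apply: eq_bigr => k _.
  by rewrite [X in X * _]mxE [X in _ = X * _]mxE !row_mx2E.
by split; [move: (E 0 0) | move: (E 1 1) | move: (E 0 1)]; rewrite mxE.
Qed.

Lemma eigen_decomposition_dotv (R : realType) (A : 'M[R]_2)
    (v1 v2 : 'cV[R]_2) (a c : R) : eigen_decomposition A (row_mx v1 v2) a c ->
  (forall x, dotv v1 (A *m x) = a * dotv v1 x) /\
  (forall x, dotv v2 (A *m x) = c * dotv v2 x).
Proof.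
move=> eA; have [n1 n2 n12] := eigen_decomposition_orthonormal eA.
have [_ ->] := (eigen_decompositionP _ _ _ _ _).1 eA.
split=> x; rewrite mulmxDl -!scalemxAl !mul_cVV !(dotvDr, dotvZr).
  by rewrite n1 n12; ring.
by rewrite (dotvC v2 v1) n12 n2; ring.
Qed.

(** Expansion in the eigenbasis, which is the completeness relation
    [v1 *m v1^T + v2 *m v2^T = 1%:M] applied to [x]. *)
Lemma eigen_decomposition_expand (R : realType) (A : 'M[R]_2)
    (v1 v2 : 'cV[R]_2) (a c : R) : eigen_decomposition A (row_mx v1 v2) a c ->
  forall x, x = dotv v1 x *: v1 + dotv v2 x *: v2.
Proof.
move=> /eigen_decompositionP[I _] x.
by rewrite -[LHS]mul1mx -I mulmxDl !mul_cVV.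
Qed.

Lemma eigen_decomposition_ext (R : realType) (A : 'M[R]_2)
    (v1 v2 : 'cV[R]_2) (a c : R) : eigen_decomposition A (row_mx v1 v2) a c ->
  forall x y, dotv v1 x = dotv v1 y -> dotv v2 x = dotv v2 y -> x = y.
Proof.
move=> /eigen_decomposition_expand E x y e1 e2.
by rewrite (E x) (E y) e1 e2.
Qed.

Lemma rot90_proj (R : realType) (u : 'cV[R]_2) : dotv u u = 1 ->
  rot90 u *m (rot90 u)^T + u *m u^T = 1%:M.
Proof.
have ord2 (i : 'I_2) : i = 0 \/ i = 1.
  by case: i => [[|[|]]] // lt; [left | right]; exact: val_inj.
rewrite /dotv mxE big_ord_recl big_ord1 !mxE (_ : lift _ _ = 1); last first.
  exact: val_inj.
move=> uu; apply/matrixP => i j; rewrite !mxE !big_ord1 !mxE.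
case: (ord2 i) => ->; case: (ord2 j) => -> /=; rewrite -?uu; ring.
Qed.

(** Passing from [v2] to [u] leaves the projector onto its line unchanged, and
    the projectors of [v1] and [rot90 u] are both its complement. *)
Lemma eigen_decomposition_rot90 (R : realType) (A : 'M[R]_2)
    (v1 v2 u : 'cV[R]_2) (a c : R) :
  eigen_decomposition A (row_mx v1 v2) a c -> u = v2 \/ u = - v2 ->
  eigen_decomposition A (row_mx (rot90 u) u) a c.
Proof.
move=> eA uv; have [_ n2 _] := eigen_decomposition_orthonormal eA.
have [I ->] := (eigen_decompositionP _ _ _ _ _).1 eA.
have uE : u *m u^T = v2 *m v2^T.
  by case: uv => ->; rewrite // linearN mulmxN mulNmx opprK.
have uu : dotv u u = 1.
  by case: uv => ->; rewrite // dotvNr dotvNl opprK.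
have rE : rot90 u *m (rot90 u)^T = v1 *m v1^T.
  by apply: (addIr (u *m u^T)); rewrite rot90_proj // uE I.
by apply/eigen_decompositionP; rewrite rE uE.
Qed.

(** * Second-order behaviour of the quadratic *)

(** By the exact expansion at [x], the increment is the vanishing linear term
    plus the nonnegative half square [2^-1 * dotv (y - x) (A *m (y - x))]. *)
Lemma quadf_le_orth_grad (R : realType) (n : nat) (A : 'M[R]_n)
    (b x y : 'cV[R]_n) : A^T = A -> (forall z, 0 <= dotv z (A *m z)) ->
  dotv (grad A b x) (y - x) = 0 -> quadf A b x <= quadf A b y.
Proof.
move=> sA psdA g0; rewrite -[X in _ <= quadf _ _ X](subrK x y).
rewrite -[y - x in X in _ <= X]scale1r quadf_expand //.
by rewrite g0 mulr0 addr0 lerDl expr1n mul1r mulr_ge0 ?invr_ge0.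
Qed.

Lemma eigen_decomposition_psd (R : realType) (A : 'M[R]_2)
    (v1 v2 : 'cV[R]_2) (a c : R) : eigen_decomposition A (row_mx v1 v2) a c ->
  0 <= a -> 0 <= c -> forall z, 0 <= dotv z (A *m z).
Proof.
move=> eA a0 c0 z; have [d1 d2] := eigen_decomposition_dotv eA.
rewrite {1}(eigen_decomposition_expand eA z) dotvDl !dotvZl d1 d2.
by rewrite 2!(mulrCA (dotv _ _)) addr_ge0 // mulr_ge0 // -expr2 sqr_ge0.
Qed.

(** A neighbourhood of [x] meets every line through [x] outside the parameter 0,
    which reduces refuting a local extremum to a single direction. *)
Lemma near_line (R : realType) (n : nat) (P : set 'cV[R]_n) (x v : 'cV[R]_n) :
  (\forall y \near x, P y) -> exists2 t : R, t != 0 & P (t *: v + x).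
Proof.
move=> Px.
have : (fun t : R => t *: v + x) @ 0^' --> (0 : R) *: v + x.
  apply: cvgD; last exact: cvg_cst.
  by apply: cvgZr_tmp; exact: nbhs_dnbhs.
rewrite scale0r add0r => cl.
have : \forall t \near (0:R)^', t != 0 /\ P (t *: v + x).
  near=> t; split; first by near: t; exact: nbhs_dnbhs_neq.
  by near: t; exact: cl.
by move=> /filter_ex[t []]; exists t.
Unshelve. all: by end_near. Qed.

(** At a stationary point the expansion along [v] has only its quadratic term,
    whose sign is that of [dotv v (A *m v)]. *)
Lemma saddle_of_signs (R : realType) (n : nat) (A : 'M[R]_n)
    (b x v w : 'cV[R]_n) : A^T = A -> stationary A b x ->
  0 < dotv v (A *m v) -> dotv w (A *m w) < 0 -> saddle_point A b x.
Proof.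
move=> sA sx pv nw; split=> // [/(near_line w)|/(near_line v)] [t t0];
  rewrite quadf_expand // sx dotv0l mulr0 addr0.
- rewrite lerDl leNgt pmulr_rlt0 ?exprn_even_gt0 //.
  by rewrite pmulr_rlt0 ?invr_gt0 // nw.
- rewrite gerDl leNgt pmulr_rgt0 ?exprn_even_gt0 //.
  by rewrite pmulr_rgt0 ?invr_gt0 // pv.
Qed.

Theorem mainTheorem5 (R : realType) (A : 'M[R]_2) (v1 v2 : 'cV[R]_2)
    (lambda1 lambda2 : R) (b x0 : 'cV[R]_2)
    (symA : A^T = A)
    (eigA : eigen_decomposition A (row_mx v1 v2) lambda1 lambda2)
    (le_lambda : lambda2 <= lambda1)
    (le_abs_lambda : `|lambda2| <= `|lambda1|)
    (lambda1_gt0 : 0 < lambda1) :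
  let f := quadf A b in
  let g := grad A b in
  let H := 1%:M - lambda1^-1 *: A in
  let x1 := gd_step A b lambda1^-1 x0 in
  let x2 := gd_step A b lambda2^-1 x1 in
  let xstar := (lambda1^-1 * dotv v1 b) *: v1
               + (lambda2^-1 * dotv v2 b) *: v2 in
  let d := x1 - lambda1^-1 *: b in
  let e := g x1 + H *m b in
  (* (i) *)
  [/\ [/\ x1 = ((1 - lambda2 / lambda1) * dotv v2 x0) *: v2 + lambda1^-1 *: b,
          (d \in <[v2]>)%VS /\ \dim <[v2]> = 1%N,
          lambda2 = rayleigh A v2,
          (lambda2 != lambda1 -> dotv v2 x0 != 0 ->
            let u2 := normalize d in
            [/\ d != 0,
                norm2 u2 = 1,
                u2 = v2 \/ u2 = - v2,
                0 < dotv v2 x0 -> u2 = v2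
              & [/\ A *m u2 = lambda2 *: u2,
                    lambda2 = rayleigh A u2
                  & (* full eigen-decomposition from the computed data *)
                    eigen_decomposition A (row_mx (rot90 u2) u2)
                      lambda1 (rayleigh A u2)]])
        & lambda2 != 0 -> forall x, stationary A b x <-> x = xstar],
  (* (ii) *)
      [/\ g x1 = (lambda2 * (1 - lambda2 / lambda1) * dotv v2 x0) *: v2 - H *m b,
          (lambda2 != lambda1 -> dotv v2 x0 != 0 -> e = 0 -> lambda2 = 0)
        & (e != 0 ->
            let u2 := normalize e in
            [/\ norm2 u2 = 1,
                A *m u2 = lambda2 *: u2,
                u2 = v2 \/ u2 = - v2
              & 0 < lambda2 * dotv v2 x0 -> u2 = v2])],
  (* (iii) *)
      (lambda2 != 0 ->
        [/\ x2 = xstar,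
            stationary A b x2,
            g x2 = 0,
            (0 < lambda1 -> 0 < lambda2 -> minimizer f x2)
          & (lambda1 * lambda2 < 0 -> saddle_point A b x2)])
  (* (iv) *)
    & (lambda2 = 0 ->
        [/\ (\rank A < 2)%N,
            x1 = dotv v2 x0 *: v2
                 + lambda1^-1 *: (dotv v1 b *: v1 + dotv v2 b *: v2),
            g x1 = - (dotv v2 b *: v2),
            (range (mulmx A) b -> g x1 = 0 /\ minimizer f x1)
          & (~ range (mulmx A) b ->
              [/\ dotv v2 b *: v2 != 0,
                  is_proj_on v2 b (dotv v2 b *: v2),
                  minimizer_on [set x1 + z | z in range (mulmx A)] f x1,
                  minimizer (fun x => norm2 (g x)) x1
                & norm2 (g x1) = `|dotv v2 b|])])].
Proof.
move=> f g H x1 x2 xstar d e.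
have [n1 n2 n12] := eigen_decomposition_orthonormal eigA.
have n21 : dotv v2 v1 = 0 by rewrite dotvC.
have [d1 d2] := eigen_decomposition_dotv eigA.
have ext := eigen_decomposition_ext eigA.
pose dE := (dotvDr, dotvNr, dotvZr, n1, n2, n12, n21, d1, d2).
have l1N0 : lambda1 != 0 by rewrite gt_eqF.
have Av2 : A *m v2 = lambda2 *: v2 by apply: ext; rewrite !dE; ring.
(* The step annihilates the v1-coordinate of x0 and scales the other one. *)
pose k := (1 - lambda2 / lambda1) * dotv v2 x0.
have x1E : x1 = k *: v2 + lambda1^-1 *: b.
  by apply: ext; rewrite /x1 /gd_step /grad /k !dE; field.
have dk : d = k *: v2 by rewrite /d x1E addrK.
have ek : e = (lambda2 * k) *: v2.
  rewrite /e /H mulmxBl mul1mx -scalemxAl /g /grad.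
  by apply: ext; rewrite x1E !dE; field.
have coef_gt0 : lambda2 != lambda1 -> 0 < 1 - lambda2 / lambda1.
  by move=> ne; rewrite subr_gt0 ltr_pdivrMr // mul1r lt_neqAle ne.
have kN0 : lambda2 != lambda1 -> dotv v2 x0 != 0 -> k != 0.
  by move=> ne x0N0; rewrite mulf_neq0 // gt_eqF // coef_gt0.
have rayl u : u = v2 \/ u = - v2 -> rayleigh A u = lambda2.
  by rewrite /rayleigh; case=> ->; rewrite ?mulmxN ?dotvNl !dE; field.
have v2N0 : v2 != 0.
  apply/eqP => v20; move/eqP: (n2).
  by rewrite v20 dotv0l eq_sym oner_eq0.
have stat x : stationary A b x <->
    lambda1 * dotv v1 x = dotv v1 b /\ lambda2 * dotv v2 x = dotv v2 b.
  split=> [sx|[e1 e2]].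
    split; apply/eqP; rewrite -subr_eq0 -?d1 -?d2 -dotvNr -dotvDr.
      by rewrite -/(grad A b x) sx dotv0r.
    by rewrite -/(grad A b x) sx dotv0r.
  by apply: ext; rewrite /grad !dE ?e1 ?e2 subrr dotv0r.
split.
- split.
  + exact: x1E.
  + by rewrite dk memvZ ?memv_line // dim_vline v2N0.
  + by rewrite rayl //; left.
  + move=> ne x0N0 u2; have kn := kN0 ne x0N0.
    have u2E : u2 = Num.sg k *: v2 by rewrite /u2 dk normalizeZ.
    have u2or : u2 = v2 \/ u2 = - v2 by rewrite u2E; exact: sgr_or.
    split=> //.
    * by rewrite dk scaler_eq0 negb_or kn.
    * by rewrite u2E norm2_sgZ.
    * by move=> x0p; rewrite u2E gtr0_sg ?scale1r // mulr_gt0 // coef_gt0.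
    * split; last by rewrite rayl //; exact: eigen_decomposition_rot90 eigA u2or.
        by rewrite u2E -scalemxAr Av2 !scalerA mulrC.
      by rewrite rayl.
  + move=> l2N0 x; rewrite stat; split=> [[e1 e2]|->].
      by apply: ext; rewrite !dE -?e1 -?e2; field; rewrite ?l1N0 ?l2N0.
    by rewrite !dE; split; field; rewrite ?l1N0 ?l2N0.
- split.
  + by apply/eqP; rewrite eq_sym subr_eq eq_sym -/e ek mulrA.
  + move=> ne x0N0 /eqP; rewrite ek scaler_eq0 (negPf v2N0) orbF mulf_eq0.
    by rewrite (negPf (kN0 ne x0N0)) orbF => /eqP.
  + rewrite ek scaler_eq0 negb_or => /andP[lkN0 _].
    rewrite normalizeZ //; split.
    * by rewrite norm2_sgZ.
    * by rewrite -scalemxAr Av2 !scalerA mulrC.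
    * exact: sgr_or.
    * move=> lx; rewrite gtr0_sg ?scale1r // /k mulrCA mulr_gt0 // coef_gt0 //.
      apply: contraNneq lkN0 => l21.
      by rewrite /k l21 divff // subrr mul0r mulr0.
- move=> l2N0.
  have x2E : x2 = xstar.
    rewrite /x2 /gd_step /grad x1E.
    by apply: ext; rewrite !dE; field; rewrite ?l1N0 ?l2N0.
  have sx2 : stationary A b x2.
    by rewrite x2E stat !dE; split; field; rewrite ?l1N0 ?l2N0.
  split=> //.
  + move=> _ l2p y; apply: quadf_le_orth_grad => //.
      by apply: eigen_decomposition_psd eigA _ _; exact: ltW.
    by rewrite sx2 dotv0l.
  + rewrite pmulr_rlt0 // => l2n.
    apply: (saddle_of_signs symA sx2 (v := v1) (w := v2)).
      by rewrite !dE mulr1.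
    by rewrite !dE mulr1.
- move=> l20.
  have gx1E : g x1 = - (dotv v2 b *: v2).
    by rewrite /g /grad x1E; apply: ext; rewrite !dE ?l20; field.
  have psdA : forall z, 0 <= dotv z (A *m z).
    by apply: eigen_decomposition_psd eigA _ _; rewrite ?l20 // ltW.
  split=> //.
  (* A kills the nonzero vector v2, so it is not invertible. *)
  + rewrite ltn_neqAle rank_leq_row andbT -[_ == _]/(row_free A) row_free_unit.
    apply: contra v2N0 => Au.
    by rewrite -(mulKmx Au v2) Av2 l20 scale0r mulmx0.
  + by rewrite x1E /k; apply: ext; rewrite !dE ?l20; field.
  + move=> [z _ zb].
    have gx10 : g x1 = 0 by rewrite gx1E -zb d2 l20 mul0r scale0r oppr0.
    split=> // y; apply: quadf_le_orth_grad => //.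
    by rewrite -/g gx10 dotv0l.
  + move=> bNA; split.
    (* If the v2-coordinate of b vanished, b would be the image under A of
       its v1-component divided by lambda1. *)
    * apply/eqP => /(congr1 (dotv v2)); rewrite !dE dotv0r mulr1 => b20.
      apply: bNA; exists ((lambda1^-1 * dotv v1 b) *: v1) => //.
      by apply: ext; rewrite !dE ?b20; field.
    * by split; [rewrite memvZ ?memv_line | rewrite !dE; ring].
    * split; first by exists 0; [exists 0; rewrite ?mulmx0 | rewrite addr0].
      move=> _ [_ [z _ <-] <-]; apply: quadf_le_orth_grad => //.
      rewrite -/(g x1) gx1E addrAC subrr add0r dotvNl dotvZl d2 l20.
      by rewrite mul0r mulr0 oppr0.
    * move=> y; rewrite gx1E -scaleNr norm2Z // normrN.
      have -> : `|dotv v2 b| = `|dotv v2 (g y)|.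
        by rewrite /g /grad !dE l20 mul0r add0r normrN.
      exact: normr_dotv_le_norm2.
    * by rewrite gx1E -scaleNr norm2Z // normrN.
Qed.
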